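(* Let $n\ge2$. The map sending each isolated word $w\in C_n^*$ to $(\mathrm{wt}(w),\mathrm{inv}(w))$ induces a bijection between the set of commutative (central) elements of $\mathrm{hypo}(\mathcal{C}_n)$ and the set of pairs $(\lambda,\delta)$ with $\lambda=(\lambda_1,\dots,\lambda_n)\in\mathbb{Z}^n$ and $\delta=(\delta_1,\dots,\delta_n)\in\{0,1\}^n$ satisfying: (1) if $\lambda_i\ne0$ for some $i\in\{1,\dots,n\}$, then $\delta_i=1$, and also $\delta_{i-1}=1$ when $i\ge2$; (2) if $\delta_i=1$ for some $i\in\{2,\dots,n\}$, then $\delta_{i-1}=1$, or $\delta_{i+1}=1$ when $i\le n-1$.
   Context: Let $n\ge2$ and $C_n=\{1<2<\cdots<n<\bar n<\overline{n-1}<\cdots<\bar 1\}$; $C_n^*$ is the free monoid of words over $C_n$ and $|w|_a$ the number of occurrences of the letter $a$ in $w$. Convention: the symbols $n+1$ and $\overline{n+1}$ never occur in any word. For $i\in\{1,\dots,n\}$, $w$ has an $i$-inversion if $w=w_1xw_2yw_3$ with $x\in\{i,\overline{i+1}\}$, $y\in\{i+1,\bar i\}$. Quasi-crystal structure on $C_n^*$: $\mathrm{wt}(w)=(|w|_1-|w|_{\bar1},\dots,|w|_n-|w|_{\bar n})\in\mathbb{Z}^n$. For $i\in\{1,\dots,n\}$: if $w$ has an $i$-inversion then $\ddot{\varepsilon}_i(w)=\ddot{\varphi}_i(w)=+\infty$ and $\ddot{e}_i(w),\ddot{f}_i(w)$ are undefined; otherwise $\ddot{\varepsilon}_i(w)=|w|_{i+1}+|w|_{\bar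 i}$, $\ddot{\varphi}_i(w)=|w|_i+|w|_{\overline{i+1}}$; $\ddot{e}_i(w)$ is defined iff $\ddot{\varepsilon}_i(w)>0$ and is obtained by replacing the right-most letter of $w$ lying in $\{i+1,\bar i\}$ by its image under the letter map $\ddot{e}_i$ ($i+1\mapsto i$, $\bar i\mapsto\overline{i+1}$ for $i<n$; $\bar n\mapsto n$ for $i=n$); $\ddot{f}_i(w)$ is defined iff $\ddot{\varphi}_i(w)>0$ and is obtained by replacing the left-most letter of $w$ lying in $\{i,\overline{i+1}\}$ by its image under the letter map $\ddot{f}_i$ ($i\mapsto i+1$, $\overline{i+1}\mapsto\bar i$ for $i<n$; $n\mapsto\bar n$ for $i=n$). The connected component $C_n^*(w)$ is the set of words obtained from $w$ by finitely many (defined) applications of the operators $\ddot{e}_i,\ddot{f}_i$; $w$ is isolated if $C_n^*(w)=\{w\}$. Hypoplactic congruence: $u\ddot{\sim}v$ iff there is a bijection $\psi:C_n^*(u)\to C_n^*(v)$ with $\psi(u)=v$ such that for all $x\in C_n^*(u)$ and $i$: $\psi(x)$ has the same $\mathrm{wt},\ddot{\varepsilon}_i,\ddot{\varphi}_i$ as $x$, $\ddot{e}_i(\psi(x))$ is defined iff $\ddot{e}_i(x)$ is (and then $\psi(\ddot{e}_i(x))=\ddot{e}_i(\psi(x))$), and likewise for $\ddot{f}_i$. It is a monoid congruence on $C_n^*$ and $\mathrm{hypo}(\mathcal{C}_n)=C_n^*/\ddot{\sim}$. For $w\in C_n^*$, $\mathrm{inv}(w)=(\delta_1,\dots,\delta_n)\in\{0,1\}^n$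 where $\delta_i=1$ iff $w$ has an $i$-inversion. *)

(* Defs.v *)
From HB Require Import structures.
From mathcomp Require Import all_boot all_order all_algebra.
From mathcomp Require Import boolp classical_sets functions constructive_ereal.

Set Implicit Arguments.
Unset Strict Implicit.
Unset Printing Implicit Defensive.

Import Order.TTheory GRing.Theory Num.Theory.

Local Open Scope classical_set_scope.
Local Open Scope quotient_scope.

Section QuasiCrystal.
Variable n : nat.
Implicit Types i : 'I_n.

(* Indices are shifted by one: [i : 'I_n] stands for the index [i.+1] of
   {1,...,n}, [inl i] for the letter [i.+1] and [inr i] for its barred version.
   The order on the alphabet plays no role below. *)
Definition letter := ('I_n + 'I_n)%type.
Definition word := seq letter.
Implicit Types (a : letter) (u v w x y : word).

(* {i, bar (i+1)} and {i+1, bar i}; no letter [j : 'I_n] satisfies [j = n], so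
   the symbols n+1 and bar (n+1) never occur. *)
Definition f_letters i : pred letter :=
  fun a => match a with inl j => j == i | inr j => j == i.+1 :> nat end.
Definition e_letters i : pred letter :=
  fun a => match a with inl j => j == i.+1 :> nat | inr j => j == i end.

(* The letter maps; only their values on [e_letters i], resp. [f_letters i],
   matter.  [insub i.+1 : option 'I_n] is [None] exactly for the last index. *)
Definition e_letter i a : letter :=
  match a with
  | inl _ => inl i
  | inr _ => if insub i.+1 is Some j then inr j else inl i
  end.
Definition f_letter i a : letter :=
  match a with
  | inl _ => if insub i.+1 is Some j then inl j else inr i
  | inr _ => inr i
  end.

Definition inversion i w : Prop :=
  exists w1 a w2 b w3,
    [/\ w = w1 ++ a :: w2 ++ b :: w3, f_letters i a & e_letters i b].
Definition has_inversion i w : bool := `[< inversion i w >].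

Definition wt w : {ffun 'I_n -> int} :=
  [ffun i => ((count_mem (inl i : letter) w)%:Z
              - (count_mem (inr i : letter) w)%:Z)%R].

Definition inversions w : {ffun 'I_n -> bool} := [ffun i => has_inversion i w].

Definition eps i w : \bar int :=
  if has_inversion i w then +oo%E else ((count (e_letters i) w)%:Z)%:E.
Definition phi i w : \bar int :=
  if has_inversion i w then +oo%E else ((count (f_letters i) w)%:Z)%:E.

Fixpoint map_first (p : pred letter) (g : letter -> letter) w : word :=
  if w is a :: w' then
    if p a then g a :: w' else a :: map_first p g w'
  else [::].
Definition map_last p g w : word := rev (map_first p g (rev w)).

Definition qe i w : option word :=
  if ~~ has_inversion i w && (0 < eps i w)%E
  then Some (map_last (e_letters i) (e_letter i) w) else None.
Definition qf i w : option word :=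
  if ~~ has_inversion i w && (0 < phi i w)%E
  then Some (map_first (f_letters i) (f_letter i) w) else None.

Inductive component w : set word :=
| component_refl : component w w
| component_e i x y : component w x -> qe i x = Some y -> component w y
| component_f i x y : component w x -> qf i x = Some y -> component w y.

Definition isolated : set word := [set w | component w = [set w]].

Definition quasi_crystal_morphism (A : set word) (psi : word -> word) : Prop :=
  forall x, A x -> wt (psi x) = wt x /\
    forall i, [/\ eps i (psi x) = eps i x, phi i (psi x) = phi i x,
      qe i (psi x) = omap psi (qe i x) & qf i (psi x) = omap psi (qf i x)].

Definition hypo_congr u v : Prop :=
  exists psi : word -> word,
    [/\ set_bij (component u) (component v) psi, psi u = v
      & quasi_crystal_morphism (component u) psi].

Lemma hypo_congr_refl u : hypo_congr u u.
Proof.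
exists id; split=> //; first by split=> // x Hx; exists x.
by move=> x _; split=> // i; split=> //; [case: qe | case: qf].
Qed.

Lemma hypo_congr_sym u v : hypo_congr u v -> hypo_congr v u.
Proof.
case=> psi [[psi_fun psi_inj psi_surj] psi_u psi_mor].
have /choice[chi chiP] : forall y, exists x,
    component v y -> component u x /\ psi x = y.
  move=> y; have [vy|nvy] := pselect (component v y); last by exists y.
  by have [x ux <-] := psi_surj _ vy; exists x.
have psiK x : component u x -> chi (psi x) = x.
  move=> ux; have [uc pc] := chiP _ (psi_fun _ ux).
  by apply: psi_inj; rewrite ?inE.
exists chi; split.
- split; first by move=> y /chiP[].
    move=> y z /[!inE] /chiP[_ Ey] /chiP[_ Ez] E.
    by rewrite -Ey -Ez E.
  move=> x ux; exists (psi x); first exact: psi_fun.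
  exact: psiK.
- by rewrite -psi_u psiK //; exact: component_refl.
- move=> y /chiP[uc <-]; move: (chi y) uc => x ux.
  rewrite psiK //; have [-> Hi] := psi_mor _ ux; split=> // i.
  have [-> -> -> ->] := Hi i; split=> //.
    case E: (qe i x) => [z|] //=; rewrite psiK //.
    exact: component_e ux E.
  case E: (qf i x) => [z|] //=; rewrite psiK //.
  exact: component_f ux E.
Qed.

Lemma hypo_congr_trans v u w :
  hypo_congr u v -> hypo_congr v w -> hypo_congr u w.
Proof.
case=> psi [psi_bij psi_u psi_mor] [chi [chi_bij chi_v chi_mor]].
have psi_fun := set_bij_homo psi_bij.
exists (chi \o psi); split; first exact: (set_bij_comp psi_bij chi_bij).
  by rewrite /= psi_u.
move=> x ux; have [-> Hx] := chi_mor _ (psi_fun _ ux).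
have [-> Hx'] := psi_mor _ ux; split=> // i.
have [/= -> -> -> ->] := Hx i; have [-> -> -> ->] := Hx' i.
by split=> //; [case: qe | case: qf].
Qed.

Lemma inversion_cat i u v : inversion i (u ++ v) <->
  [\/ inversion i u, inversion i v | has (f_letters i) u && has (e_letters i) v].
Proof.
split; last first.
  case=> [[w1 [a [w2 [b [w3 [-> fa eb]]]]]]|[w1 [a [w2 [b [w3 [-> fa eb]]]]]]|].
  - by exists w1, a, w2, b, (w3 ++ v); rewrite -!(catA, cat_cons).
  - by exists (u ++ w1), a, w2, b, w3; rewrite -!(catA, cat_cons).
  - case/andP=> /hasP[a au fa] /hasP[b bv eb].
    have [u1 u2] := splitPr au; have [v1 v2] := splitPr bv.
    by exists u1, a, (u2 ++ v1), b, v2; rewrite -!(catA, cat_cons).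
elim: u => [|c u IHu] /=; first by constructor 2.
case=> -[|d w1] [a [w2 [b [w3 [/= [-> E] fa eb]]]]].
  rewrite fa /=.
  have : has (e_letters i) (u ++ v).
    by apply/hasP; exists b; rewrite // E mem_cat inE eqxx orbT.
  rewrite has_cat; case: (boolP (has _ v)) => [_ _|_]; first by constructor 3.
  rewrite orbF => /hasP[b' b'u eb']; constructor 1.
  by have [u1 u2] := splitPr b'u; exists [::], a, u1, b', u2.
have [|[w1' [a' [w2' [b' [w3' [-> fa' eb']]]]]]|H|/andP[H1 H2]] := IHu.
- by exists w1, a, w2, b, w3.
- by constructor 1; exists (d :: w1'), a', w2', b', w3'.
- by constructor 2.
- by constructor 3; rewrite H1 H2 orbT.
Qed.

Lemma has_inversion_cat_has i u v : has_inversion i (u ++ v) =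
  [|| has_inversion i u, has_inversion i v
    | has (f_letters i) u && has (e_letters i) v].
Proof.
apply/asboolP/or3P => [/inversion_cat[]H|[]H].
- by constructor 1; apply/asboolP.
- by constructor 2; apply/asboolP.
- by constructor 3.
- by apply/inversion_cat; constructor 1; apply/asboolP.
- by apply/inversion_cat; constructor 2; apply/asboolP.
- by apply/inversion_cat; constructor 3.
Qed.

Lemma eps_pinfty i w : (eps i w == +oo%E) = has_inversion i w.
Proof. by rewrite /eps; case: ifP. Qed.

Lemma eps_gt0 i w : (0 < eps i w)%E = has_inversion i w || has (e_letters i) w.
Proof. by rewrite /eps has_count; case: ifP. Qed.

Lemma phi_gt0 i w : (0 < phi i w)%E = has_inversion i w || has (f_letters i) w.
Proof. by rewrite /phi has_count; case: ifP. Qed.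

Lemma has_inversion_cat i u v : has_inversion i (u ++ v) =
  [|| eps i u == +oo%E, eps i v == +oo%E
    | (0 < phi i u)%E && (0 < eps i v)%E].
Proof.
rewrite has_inversion_cat_has !eps_pinfty phi_gt0 eps_gt0.
by case: has_inversion => //; case: has_inversion.
Qed.

Lemma wt_cat u v : wt (u ++ v) = (wt u + wt v)%R.
Proof.
by apply/ffunP => i; rewrite !ffunE !count_cat !PoszD opprD addrACA.
Qed.

Lemma eps_cat i u v : eps i (u ++ v) =
  if has_inversion i (u ++ v) then +oo%E else (eps i u + eps i v)%E.
Proof.
rewrite {1}/eps; case: ifP => // /negbT.
rewrite has_inversion_cat_has => /norP[Hu /norP[Hv _]].
by rewrite /eps (negbTE Hu) (negbTE Hv) count_cat PoszD EFinD.
Qed.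

Lemma phi_cat i u v : phi i (u ++ v) =
  if has_inversion i (u ++ v) then +oo%E else (phi i u + phi i v)%E.
Proof.
rewrite {1}/phi; case: ifP => // /negbT.
rewrite has_inversion_cat_has => /norP[Hu /norP[Hv _]].
by rewrite /phi (negbTE Hu) (negbTE Hv) count_cat PoszD EFinD.
Qed.

Lemma map_first_cat p g u v : map_first p g (u ++ v) =
  if has p u then map_first p g u ++ v else u ++ map_first p g v.
Proof. by elim: u => //= a u ->; case: (p a) => //=; case: has. Qed.

Lemma map_last_cat p g u v : map_last p g (u ++ v) =
  if has p v then u ++ map_last p g v else map_last p g u ++ v.
Proof.
rewrite /map_last rev_cat map_first_cat has_rev.
by case: has; rewrite rev_cat revK.
Qed.

Lemma qe_cat i u v : qe i (u ++ v) =
  if has_inversion i (u ++ v) then None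
  else if qe i v is Some v' then Some (u ++ v') else omap (cat^~ v) (qe i u).
Proof.
have [|] := boolP (has_inversion i (u ++ v)); first by rewrite /qe => ->.
move=> Huv; move: (Huv); rewrite has_inversion_cat_has => /norP[Hu /norP[Hv _]].
rewrite /qe !eps_gt0 Huv (negbTE Huv) Hu Hv (negbTE Hu) (negbTE Hv) /=.
by rewrite has_cat map_last_cat; case: (has _ v); case: (has _ u).
Qed.

Lemma qf_cat i u v : qf i (u ++ v) =
  if has_inversion i (u ++ v) then None
  else if qf i u is Some u' then Some (u' ++ v) else omap (cat u) (qf i v).
Proof.
have [|] := boolP (has_inversion i (u ++ v)); first by rewrite /qf => ->.
move=> Huv; move: (Huv); rewrite has_inversion_cat_has => /norP[Hu /norP[Hv _]].
rewrite /qf !phi_gt0 Huv (negbTE Huv) Hu Hv (negbTE Hu) (negbTE Hv) /=.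
by rewrite has_cat map_first_cat; case: (has _ u); case: (has _ v).
Qed.

Lemma size_map_first p g w : size (map_first p g w) = size w.
Proof. by elim: w => //= a w IHw; case: (p a) => //=; rewrite IHw. Qed.

Lemma size_component w x : component w x -> size x = size w.
Proof.
elim=> // i y z _ <-; rewrite /qe /qf; case: ifP => // _ [<-].
  by rewrite /map_last size_rev size_map_first size_rev.
by rewrite size_map_first.
Qed.

Lemma component_cat u v x : component (u ++ v) x ->
  exists x1 x2, [/\ component u x1, component v x2 & x = x1 ++ x2].
Proof.
elim=> [|i y z _ [y1 [y2 [uy1 vy2 ->]]]|i y z _ [y1 [y2 [uy1 vy2 ->]]]].
- by exists u, v; split=> //; exact: component_refl.
- rewrite qe_cat; case: ifP => // _.
  case E2: (qe i y2) => [z2|].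
    by case=> <-; exists y1, z2; split=> //; exact: component_e vy2 E2.
  case E1: (qe i y1) => [z1|] //= [<-].
  by exists z1, y2; split=> //; exact: component_e uy1 E1.
- rewrite qf_cat; case: ifP => // _.
  case E1: (qf i y1) => [z1|].
    by case=> <-; exists z1, y2; split=> //; exact: component_f uy1 E1.
  case E2: (qf i y2) => [z2|] //= [<-].
  by exists y1, z2; split=> //; exact: component_f vy2 E2.
Qed.

Lemma morphism_component u psi : quasi_crystal_morphism (component u) psi ->
  set_fun (component u) (component (psi u)) psi /\
  set_surj (component u) (component (psi u)) psi.
Proof.
move=> psi_mor; split.
  move=> x /=; elim=> [|i y z uy IHy E|i y z uy IHy E].
  - exact: component_refl.
  - apply: (component_e (i := i) IHy).
    by have [_ /(_ i)[_ _ -> _]] := psi_mor _ uy; rewrite E.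
  - apply: (component_f (i := i) IHy).
    by have [_ /(_ i)[_ _ _ ->]] := psi_mor _ uy; rewrite E.
move=> y; elim=> [|i y' z _ [x ux <-]|i y' z _ [x ux <-]].
- by exists u => //; exact: component_refl.
- have [_ /(_ i)[_ _ -> _]] := psi_mor _ ux.
  case E: (qe i x) => [t|] //= [<-].
  by exists t => //; exact: component_e ux E.
- have [_ /(_ i)[_ _ _ ->]] := psi_mor _ ux.
  case E: (qf i x) => [t|] //= [<-].
  by exists t => //; exact: component_f ux E.
Qed.

Lemma hypo_congr_cat u u' v v' :
  hypo_congr u v -> hypo_congr u' v' -> hypo_congr (u ++ u') (v ++ v').
Proof.
case=> psi [[psi_fun psi_inj _] psi_u psi_mor].
case=> psi' [[psi'_fun psi'_inj _] psi'_u psi'_mor].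
pose chi x := psi (take (size u) x) ++ psi' (drop (size u) x).
have chiE x x' : component u x -> chi (x ++ x') = psi x ++ psi' x'.
  move=> /size_component sx; rewrite /chi take_cat drop_cat sx ltnn subnn.
  by rewrite take0 drop0 cats0.
have chi_u : chi (u ++ u') = v ++ v'.
  by rewrite chiE ?psi_u ?psi'_u //; exact: component_refl.
have chi_mor : quasi_crystal_morphism (component (u ++ u')) chi.
  move=> _ /component_cat[x [x' [ux u'x' ->]]]; rewrite chiE //.
  have [Ew Ei] := psi_mor _ ux; have [Ew' Ei'] := psi'_mor _ u'x'.
  split=> [|i]; first by rewrite !wt_cat Ew Ew'.
  have [Ee Ef Eqe Eqf] := Ei i; have [Ee' Ef' Eqe' Eqf'] := Ei' i.
  have Einv : has_inversion i (psi x ++ psi' x') = has_inversion i (x ++ x').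
    by rewrite !has_inversion_cat Ee Ee' Ef.
  rewrite !eps_cat !phi_cat !qe_cat !qf_cat Einv Ee Ef Ee' Ef' Eqe Eqf Eqe' Eqf'.
  split=> //; case: ifP => // _.
    case: (qe i x') => [z'|] /=; first by rewrite chiE.
    case E: (qe i x) => [z|] //=; rewrite chiE //.
    exact: component_e ux E.
  case E: (qf i x) => [z|] /=.
    by rewrite chiE //; exact: component_f ux E.
  by case: (qf i x') => [z'|] //=; rewrite chiE.
exists chi; split=> //.
have [] := morphism_component chi_mor; rewrite chi_u => chi_fun chi_surj.
split=> // z t /[!inE] /component_cat[x [x' [ux u'x' ->]]].
move=> /component_cat[y [y' [uy u'y' ->]]]; rewrite !chiE // => /eqP.
rewrite eqseq_cat; last first.
  by rewrite (size_component (psi_fun _ ux)) (size_component (psi_fun _ uy)).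
case/andP=> /eqP Exy /eqP Exy'.
by rewrite (psi_inj x y) ?inE // (psi'_inj x' y') ?inE.
Qed.

Definition hypo_rel : rel word := fun u v => `[< hypo_congr u v >].

Lemma hypo_rel_refl : reflexive hypo_rel.
Proof. by move=> u; apply/asboolP/hypo_congr_refl. Qed.

Lemma hypo_rel_sym : symmetric hypo_rel.
Proof. by move=> u v; apply/asboolP/asboolP; exact: hypo_congr_sym. Qed.

Lemma hypo_rel_trans : transitive hypo_rel.
Proof.
by move=> v u w /asboolP uv /asboolP vw; apply/asboolP/(hypo_congr_trans uv vw).
Qed.

Canonical hypo_equiv :=
  EquivRel hypo_rel hypo_rel_refl hypo_rel_sym hypo_rel_trans.

Definition hypo := {eq_quot hypo_equiv}.

HB.instance Definition _ := Choice.on hypo.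
HB.instance Definition _ := Quotient.on hypo.

Lemma pi_hypoP u v : \pi_hypo u = \pi_hypo v <-> hypo_congr u v.
Proof.
by split=> [/(@eqmodP _ hypo_equiv)/asboolP|/asboolP/(@eqmodP _ hypo_equiv)].
Qed.

Definition hypo_one : hypo := \pi_hypo [::].
Definition hypo_mul : hypo -> hypo -> hypo := lift_op2 hypo (@cat letter).

Lemma pi_hypo_mul : {morph \pi_hypo : u v / u ++ v >-> hypo_mul u v}.
Proof.
move=> u v; unlock hypo_mul; apply/pi_hypoP.
by apply: hypo_congr_cat; apply/pi_hypoP; rewrite reprK.
Qed.

Lemma hypo_mulA : associative hypo_mul.
Proof.
by elim/quotW=> u; elim/quotW=> v; elim/quotW=> w; rewrite -!pi_hypo_mul catA.
Qed.

Lemma hypo_mul1 : left_id hypo_one hypo_mul.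
Proof. by elim/quotW=> u; rewrite -pi_hypo_mul. Qed.

Lemma hypo_mulr1 : right_id hypo_one hypo_mul.
Proof. by elim/quotW=> u; rewrite -pi_hypo_mul cats0. Qed.

HB.instance Definition _ := isMonoid.Build hypo hypo_mulA hypo_mul1 hypo_mulr1.

(* With shifted indices, [j.+1 = i] says that j is the index i-1 (so i is not
   the first index) and [j = i.+1] that j is i+1 (so i is not the last one). *)
Definition admissible : set ({ffun 'I_n -> int} * {ffun 'I_n -> bool}) :=
  [set p : {ffun 'I_n -> int} * {ffun 'I_n -> bool} |
    (forall i, p.1 i != 0%R ->
       p.2 i /\ (forall j : 'I_n, j.+1 = i :> nat -> p.2 j)) /\
    (forall i, (0 < i)%N -> p.2 i ->
       (exists j : 'I_n, j.+1 = i :> nat /\ p.2 j) \/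
       (exists j : 'I_n, j = i.+1 :> nat /\ p.2 j))].

End QuasiCrystal.

Definition central (M : monoidType) : set M :=
  [set a | forall b : M, commute a b].

Arguments central M : clear implicits.
Arguments isolated : clear implicits.
Arguments admissible : clear implicits.

(* Main.v *)
Require Import Defs.
From mathcomp Require Import all_boot all_order all_algebra.
From mathcomp Require Import boolp classical_sets functions constructive_ereal.

(** A word is isolated iff every index [i] for which one of its letters belongs
    to the domain of the letter maps [e_i], [f_i] is the index of an inversion.
    If [w] is isolated, then in [w ++ x] and in [x ++ w] each operator is either
    blocked by [w] or acts inside [x], so moving [w] across [x] is an
    isomorphism of components and [w] is central.  If [u] is not isolated, some
    [i] without [i]-inversion has a letter of [u] in its domain, and putting the
    single letter [i] or [bar i] before or after [u] creates an [i]-inversion on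
    one side only.  An isolated component being a point, the class of an
    isolated word is determined by its weight and inversions.  A pair
    [(lambda, delta)] is realised by concatenating, over the indices [k] with
    [delta_k = delta_(k-1) = 1], the words [k (bar k) k (bar k)] followed by
    [|lambda_k|] copies of [k] or [bar k]. *)

Set Implicit Arguments.
Unset Strict Implicit.
Unset Printing Implicit Defensive.

Import Order.TTheory GRing.Theory Num.Theory.

Local Open Scope classical_set_scope.
Local Open Scope quotient_scope.

Section IsolatedWords.
Variable n : nat.
Implicit Types (i j k : 'I_n) (u v w x y : word n).

(** * Characterisation of isolated words *)

Lemma e_letterN i a : e_letters i a -> e_letter i a != a.
Proof.
case: a => j /= /eqP E.
  by apply/eqP => -[] /(congr1 val) /= H; rewrite -H in E; have := n_Sn i; rewrite -E.
rewrite E; case: insubP => [k _ Ek|//]; apply/eqP => -[] H.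
by rewrite H in Ek; have := n_Sn i; rewrite -Ek.
Qed.

Lemma f_letterN i a : f_letters i a -> f_letter i a != a.
Proof.
case: a => j /= /eqP E.
  rewrite E; case: insubP => [k _ Ek|//]; apply/eqP => -[] H.
  by rewrite H in Ek; have := n_Sn i; rewrite -Ek.
by apply/eqP => -[] /(congr1 val) /= H; rewrite -H in E; have := n_Sn i; rewrite -E.
Qed.

Lemma map_first_neq (p : pred (letter n)) g w :
  (forall a, p a -> g a != a) -> has p w -> map_first p g w != w.
Proof.
move=> gN; elim: w => //= a w IHw.
case: ifP => [pa _|_ /= /IHw]; rewrite eqseq_cons.
  by rewrite (negbTE (gN _ pa)).
by rewrite eqxx.
Qed.

Lemma map_last_neq (p : pred (letter n)) g w :
  (forall a, p a -> g a != a) -> has p w -> map_last p g w != w.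
Proof.
by move=> gN pw; rewrite -(inj_eq (can_inj revK)) revK map_first_neq // has_rev.
Qed.

(** A defined operator changes one letter and hence the word, so isolation means that every operator
    is undefined at [w]. Without an [i]-inversion this happens exactly when no letter of [w] lies in
    either domain of index [i]. *)
Lemma isolatedP w : isolated n w <->
  forall i, has (f_letters i) w || has (e_letters i) w -> has_inversion i w.
Proof.
split=> [iso i|inv]; last first.
  apply/seteqP; split=> [x|_ ->]; last exact: component_refl.
  elim=> // i y z _ ->.
    rewrite /qe eps_gt0; have := inv i.
    by case: has_inversion => //=; case: (has (e_letters i) w); rewrite ?orbT // => /(_ isT).
  rewrite /qf phi_gt0; have := inv i.
  by case: has_inversion => //=; case: (has (f_letters i) w) => //= /(_ isT).
have fix_w y : component w y -> y = w by rewrite iso.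
apply: contraTT => inv; apply/norP; split; apply/negP => lw.
  have /fix_w/eqP : component w (map_first (f_letters i) (f_letter i) w).
    apply: (component_f (i := i) (component_refl w)).
    by rewrite /qf inv phi_gt0 lw orbT.
  by apply/negP/map_first_neq => //; exact: f_letterN.
have /fix_w/eqP : component w (map_last (e_letters i) (e_letter i) w).
  apply: (component_e (i := i) (component_refl w)).
  by rewrite /qe inv eps_gt0 lw orbT.
by apply/negP/map_last_neq => //; exact: e_letterN.
Qed.

Lemma isolated_inversion w i a : isolated n w -> a \in w ->
  f_letters i a || e_letters i a -> has_inversion i w.
Proof.
move/isolatedP => iso aw /orP[] H; apply: iso; apply/orP; [left|right];
  by apply/hasP; exists a.
Qed.

(** * Isolated words commute with all words *)

Lemma has_inversion_catl_isolated w x i : isolated n w ->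
  has_inversion i (w ++ x) = has_inversion i w || has_inversion i x.
Proof.
move/isolatedP/(_ i); rewrite has_inversion_cat_has.
(* An inversion across the cut takes its first letter from [w], which then already has an
   [i]-inversion. *)
case: (has_inversion i w) => //; case: (has (f_letters i) w) => [/(_ isT)|] // _.
by rewrite orbF.
Qed.

Lemma has_inversion_catr_isolated w x i : isolated n w ->
  has_inversion i (x ++ w) = has_inversion i w || has_inversion i x.
Proof.
move/isolatedP/(_ i); rewrite has_inversion_cat_has.
case: (has_inversion i w); first by rewrite orbT.
by case: (has (e_letters i) w); rewrite ?orbT ?andbF ?orbF => // /(_ isT).
Qed.

Lemma isolated_qeN w i : isolated n w -> qe i w = None.
Proof.
move/isolatedP/(_ i); rewrite /qe eps_gt0.
by case: has_inversion => //=; case: (has (e_letters i) w); rewrite ?orbT // => /(_ isT).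
Qed.

Lemma isolated_qfN w i : isolated n w -> qf i w = None.
Proof.
move/isolatedP/(_ i); rewrite /qf phi_gt0.
by case: has_inversion => //=; case: (has (f_letters i) w) => //= /(_ isT).
Qed.

(** The prefix [w] is fixed by all operators, so the component of [w ++ v] consists of words
    [w ++ x], and rotation by [size w] serves as the isomorphism. *)
Lemma hypo_congr_isolated_catC w v :
  isolated n w -> hypo_congr (w ++ v) (v ++ w).
Proof.
move=> iso; have rotE x : rot (size w) (w ++ x) = x ++ w by rewrite rot_size_cat.
have compE y : component (w ++ v) y -> exists x, y = w ++ x.
  move=> /component_cat[w' [x [ww' _ ->]]]; exists x.
  by move: ww'; rewrite iso => ->.
have rot_mor : quasi_crystal_morphism (component (w ++ v)) (rot (size w)).
  move=> _ /compE[x ->]; rewrite rotE; split=> [|i].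
    by rewrite !wt_cat addrC.
  rewrite !eps_cat !phi_cat !qe_cat !qf_cat (isolated_qeN _ iso) (isolated_qfN _ iso).
  rewrite (has_inversion_catl_isolated _ _ iso) (has_inversion_catr_isolated _ _ iso).
  rewrite [(eps i w + _)%E]addeC [(phi i w + _)%E]addeC.
  by case: ifP; split=> //; [case: (qe i x) | case: (qf i x)] => //= y; rewrite rotE.
have [] := morphism_component rot_mor; rewrite rotE => rot_fun rot_surj.
exists (rot (size w)); split=> //; split=> // x y _ _; exact: rot_inj.
Qed.

(** * Weight and inversions as invariants of classes *)

Lemma hypo_congr_isolated u v : isolated n u -> isolated n v ->
  wt u = wt v -> inversions u = inversions v -> hypo_congr u v.
Proof.
move=> isou isov Ewt /ffunP Einv.
(* Without an [i]-inversion, an isolated word has no letter in either domain, so both counts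
   vanish. *)
have eps_phi w i : isolated n w ->
    eps i w = (if has_inversion i w then +oo else 0)%E /\
    phi i w = (if has_inversion i w then +oo else 0)%E.
  move=> /isolatedP/(_ i); rewrite /eps /phi.
  case: has_inversion => // H; split; congr (_%:Z)%:E; apply/eqP;
  by rewrite -leqn0 leqNgt -has_count; apply/negP => lw;
     have : false by apply: H; rewrite lw ?orbT.
exists (fun=> v); split=> //.
  rewrite isou isov; split=> [x _ //|x y|_ ->]; first by rewrite !inE => -> ->.
  by exists u.
move=> x; rewrite isou => ->; split=> // i.
have [-> ->] := eps_phi u i isou; have [-> ->] := eps_phi v i isov.
have := Einv i; rewrite !ffunE => ->.
by rewrite !isolated_qeN // !isolated_qfN.
Qed.

Lemma hypo_congr_invariants u v : hypo_congr u v ->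
  wt u = wt v /\ inversions u = inversions v.
Proof.
case=> psi [_ <- psi_mor]; have [Ew Ei] := psi_mor _ (component_refl u).
split=> //; apply/ffunP => i; rewrite !ffunE -!eps_pinfty.
by have [-> _ _ _] := Ei i.
Qed.

(** * Central classes are the classes of isolated words *)

Lemma isolated_of_catC u :
  (forall v, hypo_congr (u ++ v) (v ++ u)) -> isolated n u.
Proof.
move=> uC; apply/isolatedP => i lu; apply: contraT => inv.
have inv1 a : has_inversion i [:: a] = false.
  by apply/asboolP => -[[|? [|? ?]] [? [[|? ?] [? [? []]]]]].
have inl_eN : (i == i.+1 :> nat) = false by apply/eqP/n_Sn.
have invC a : has_inversion i (u ++ [:: a]) = has_inversion i ([:: a] ++ u).
  by have [_ /ffunP/(_ i)] := hypo_congr_invariants (uC [:: a]); rewrite !ffunE.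
(* Of the two domains of index [i], [inr i] lies only in [e_letters i]: placed after a letter of
   [f_letters i] it ends an inversion, placed before [u] it starts none. The letter [inl i] plays
   the mirror role. *)
case/orP: lu => lu; [have := invC (inr i) | have := invC (inl i)];
  rewrite !has_inversion_cat_has !inv1 (negbTE inv) lu /= ?eqxx ?inl_eN;
  by rewrite ?andbF.
Qed.

Lemma central_isolated :
  [set \pi_(hypo n) w | w in isolated n] = central (hypo n).
Proof.
apply/seteqP; split=> [_ [w iso <-]|].
  elim/quotW=> v; rewrite /commute /= -[LHS]pi_hypo_mul -[RHS]pi_hypo_mul.
  exact/pi_hypoP/hypo_congr_isolated_catC.
elim/quotW=> u uC; exists u => //; apply: isolated_of_catC => v.
apply/pi_hypoP; rewrite !pi_hypo_mul; exact: uC.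
Qed.

(** * Admissibility of the invariants of an isolated word *)

Lemma isolated_admissible w : isolated n w -> admissible n (wt w, inversions w).
Proof.
move=> iso; split=> i /=; rewrite !ffunE.
  move=> wi0; have [a aw ai] : exists2 a, a \in w & (a == inl i) || (a == inr i).
    have [iw|iNw] := boolP (inl i \in w); first by exists (inl i); rewrite ?eqxx.
    have [iw|iNw'] := boolP (inr i \in w); first by exists (inr i); rewrite ?eqxx.
    by move: wi0; rewrite !(count_memPn _) // subr0 eqxx.
  split=> [|j ji]; rewrite ?ffunE; apply: (isolated_inversion iso aw).
    by case/orP: ai => /eqP -> /=; rewrite eqxx ?orbT.
  by case/orP: ai => /eqP -> /=; rewrite ji eqxx ?orbT.
move=> i_gt0 /asboolP[w1 [a [w2 [b [w3 [E ai _]]]]]].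
have aw : a \in w by rewrite E mem_cat inE eqxx orbT.
(* The first letter of the inversion is [i] or [bar (i+1)]. The former also lies in a domain of
   index [i-1], the latter in one of index [i+1], and isolation gives an inversion there. *)
case: a aw ai {E} => j aw /= /eqP Ej.
  have lt_i1n : (i.-1 < n)%N by apply: leq_ltn_trans (ltn_ord i); exact: leq_pred.
  left; exists (Ordinal lt_i1n); rewrite /= prednK //; split=> //.
  by rewrite ffunE; apply: (isolated_inversion iso aw); rewrite /= Ej prednK // eqxx orbT.
right; exists j; split=> //; rewrite ffunE.
by apply: (isolated_inversion iso aw); rewrite /= eqxx orbT.
Qed.

(** * An isolated word for each admissible pair *)

Lemma wt_flatten (s : seq (word n)) : wt (flatten s) = (\sum_(w <- s) wt w)%R.
Proof.
elim: s => [|w s IHs] /=; last by rewrite big_cons wt_cat IHs.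
by rewrite big_nil; apply/ffunP => i; rewrite !ffunE subrr.
Qed.

Lemma inversion_flatten (s : seq (word n)) w i :
  w \in s -> inversion i w -> inversion i (flatten s).
Proof.
elim: s => //= v s IHs; rewrite inE => /predU1P[->|ws] iw; apply/inversion_cat.
  by constructor 1.
by constructor 2; exact: IHs.
Qed.

(** The four-letter prefix has weight zero and contains both [k] before [bar k], a [k]-inversion,
    and [bar k] before [k], a [(k-1)]-inversion when [k-1] exists. The tail carries the weight
    [z]. *)
Definition weight_block k (z : int) : word n :=
  [:: inl k; inr k; inl k; inr k] ++
  nseq `|z|%N (if (0 <= z)%R then inl k else inr k).

Lemma mem_weight_block k z a : a \in weight_block k z -> a = inl k \/ a = inr k.
Proof.
rewrite mem_cat mem_nseq !inE; case: ifP => _;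
  by repeat (case/orP); repeat (case/andP => _);
     (try by move/eqP; auto); move/eqP; auto.
Qed.

Lemma wt_weight_block k z i :
  wt (weight_block k z) i = (if k == i then z else 0)%R.
Proof.
rewrite ffunE !count_cat !count_nseq /=.
have inlE (j j' : 'I_n) : (inl j == inl j' :> letter n) = (j == j') by [].
have inrE (j j' : 'I_n) : (inr j == inr j' :> letter n) = (j == j') by [].
case: ifP => /= z0; rewrite !inlE !inrE /=; case: (k == i) => //=.
- by rewrite mul0n mul1n addn0 (PoszD 2 `|z|%N) addrAC subrr add0r gez0_abs.
- by rewrite mul0n mul1n (PoszD 2 `|z|%N) opprD addNKr ltz0_abs ?opprK // ltNge z0.
Qed.

(** These are the [k] whose letters [k] and [bar k] may occur in an isolated word with inversions
    [d], since their domains have indices [k] and [k-1]. For the first index the second condition is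
    vacuous. *)
Definition free_index (d : {ffun 'I_n -> bool}) : pred 'I_n :=
  fun k => d k && [forall j : 'I_n, (j.+1 == k :> nat) ==> d j].

Definition realizer (p : {ffun 'I_n -> int} * {ffun 'I_n -> bool}) : word n :=
  flatten [seq weight_block k (p.1 k) | k <- enum (free_index p.2)].

Lemma mem_realizer p a : a \in realizer p ->
  exists2 k, free_index p.2 k & a = inl k \/ a = inr k.
Proof.
by case/flatten_mapP => k; rewrite mem_enum => kd /mem_weight_block; exists k.
Qed.

Lemma realizer_letter p i :
  has (f_letters i) (realizer p) || has (e_letters i) (realizer p) -> p.2 i.
Proof.
case/orP => /hasP[a /mem_realizer[k /andP[kd /forallP/(_ i) kd']]] [] -> /= /eqP E.
- by rewrite -E.
- by rewrite E eqxx in kd'.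
- by rewrite E eqxx in kd'.
- by rewrite -E.
Qed.

Lemma wt_realizer p : admissible n p -> wt (realizer p) = p.1.
Proof.
case=> adm _; apply/ffunP => i; rewrite wt_flatten big_map big_enum /= sum_ffunE.
under eq_bigr do rewrite wt_weight_block.
rewrite -big_mkcondr /=; have [id|iNd] := boolP (free_index p.2 i).
  rewrite (big_pred1 i) // => k /=.
  by apply/andP/eqP => [[_ /eqP]|->] //; rewrite eqxx.
rewrite big_pred0 => [|k]; last first.
  by apply: contraNF iNd => /andP[kd /eqP <-].
(* No block contributes at a non-free index, and there the first admissibility condition forces the
   weight to be zero. *)
apply/esym/eqP; apply: contraNT iNd => /adm[id idp]; apply/andP; split=> //.
by apply/forallP => j; apply/implyP => /eqP /idp.
Qed.

(** The two alternatives encode [i = k] and [i = k-1]; the prefix of the block at [k] supplies the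
    inversion in each case. *)
Lemma inversion_realizer p i k : free_index p.2 k ->
  f_letters i (inl k) && e_letters i (inr k) ||
  f_letters i (inr k) && e_letters i (inl k) ->
  has_inversion i (realizer p).
Proof.
move=> kd H; apply/asboolP.
apply: (@inversion_flatten _ (weight_block k (p.1 k))).
  by apply: map_f; rewrite mem_enum.
rewrite /weight_block; set r := nseq _ _; case/orP: H => /andP[H1 H2].
  by exists [::], (inl k), [::], (inr k), [:: inl k, inr k & r].
by exists [:: inl k], (inr k), [::], (inl k), (inr k :: r).
Qed.

Lemma has_inversion_realizer p i :
  admissible n p -> has_inversion i (realizer p) = p.2 i.
Proof.
case=> _ adm; apply/idP/idP => [|di].
  case/asboolP => w1 [a [w2 [b [w3 [E ai _]]]]]; apply: realizer_letter.
  by apply/orP; left; apply/hasP; exists a; rewrite // E mem_cat inE eqxx orbT.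
have free_pred j : j = i.+1 :> nat -> p.2 j -> free_index p.2 j.
  move=> ji dj; rewrite /free_index dj; apply/forallP => j'.
  by apply/implyP; rewrite ji eqSS => /eqP/val_inj ->.
(* Some block must produce the [i]-inversion: the one at [i] if [i] is the first index or [i-1] is
   marked, and otherwise the one at [i+1], as the second admissibility condition ensures. *)
have [i0|i_gt0] := posnP i.
  apply: (@inversion_realizer _ _ i); last by rewrite /= !eqxx.
  by rewrite /free_index di; apply/forallP => j; rewrite i0.
have [[j [ji dj]]|[j [ji dj]]] := adm _ i_gt0 di.
  apply: (@inversion_realizer _ _ i); last by rewrite /= !eqxx.
  rewrite /free_index di; apply/forallP => j'; apply/implyP.
  by rewrite -ji eqSS => /eqP/val_inj ->.
apply: (@inversion_realizer _ _ j); first exact: free_pred.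
by rewrite /= ji !eqxx orbT.
Qed.

Lemma isolated_realizer p : admissible n p -> isolated n (realizer p).
Proof.
by move=> adm; apply/isolatedP => i /realizer_letter; rewrite has_inversion_realizer.
Qed.

End IsolatedWords.

Theorem theorem9p21 (n : nat) (n_ge2 : (2 <= n)%N) :
  [set \pi_(hypo n) w | w in isolated n] = central (hypo n) /\
  exists F : hypo n -> {ffun 'I_n -> int} * {ffun 'I_n -> bool},
    (forall w : word n, isolated n w -> F (\pi_(hypo n) w) = (wt w, inversions w)) /\
    set_bij (central (hypo n)) (admissible n) F.
Proof.
split; first exact: central_isolated.
(* The chosen representative may fail to be isolated; invariance of weight and inversions under the
   congruence makes the choice harmless. *)
pose F (q : hypo n) := (wt (repr q), inversions (repr q)).
have FE w : F (\pi_(hypo n) w) = (wt w, inversions w).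
  have /pi_hypoP/hypo_congr_invariants[Ew Ei] :
    \pi_(hypo n) (repr (\pi_(hypo n) w)) = \pi_(hypo n) w by rewrite reprK.
  by rewrite /F Ew Ei.
exists F; split=> [w _ //|]; rewrite -central_isolated; split.
- by move=> _ [w iso <-] /=; rewrite FE; exact: isolated_admissible.
- move=> q q' /[!inE] -[w iso <-] [w' iso' <-]; rewrite !FE => -[Ew Ei].
  exact/pi_hypoP/hypo_congr_isolated.
- move=> p adm; exists (\pi_(hypo n) (realizer p)).
    by exists (realizer p) => //; exact: isolated_realizer.
  rewrite FE wt_realizer // [RHS]surjective_pairing; congr pair.
  by apply/ffunP => i; rewrite ffunE has_inversion_realizer.
Qed.
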